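(* Let $k$ be an infinite field, let $S$ be a numerical semigroup with smallest minimal generator $g_1$, and let $R=k[[t^S]]$. If $\mathrm{e.d.}(S)\in\{4,5\}$ and $g_1\le 8$, then the Hilbert function $H_R$ is non-decreasing.
   Context: A numerical semigroup $S$ is a subsemigroup of $(\mathbb{N},+)$ containing $0$; $S=\langle g_1,\dots,g_n\rangle$ means that $g_1<g_2<\dots<g_n$ is its minimal set of generators, and it is assumed that $\gcd(g_1,\dots,g_n)=1$ (equivalently $\mathbb{N}\setminus S$ is finite). The embedding dimension $\mathrm{e.d.}(S)$ is the cardinality $n$ of the minimal set of generators. Put $M=S\setminus\{0\}$, $0M=S$, and for $h\ge 1$ let $hM=\{m_1+\dots+m_h : m_1,\dots,m_h\in M\}$. The semigroup ring is $R=k[[t^S]]=k[[t^{g_1},\dots,t^{g_n}]]$, a one-dimensional local domain with maximal ideal $\mathfrak{m}=(t^{g_1},\dots,t^{g_n})$. Its Hilbert function is $H_R(h)=\dim_k \mathfrak{m}^h/\mathfrak{m}^{h+1}$ for $h\ge 0$ (with $\mathfrak{m}^0=R$), and one has $H_R(h)=|hM\setminus (h+1)M|$ for all $h\ge 0$. Non-decreasing means $H_R(h-1)\le H_R(h)$ for all $h\ge 1$. *)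

(* Defs.v *)
From HB Require Import structures.
From mathcomp Require Import all_boot all_order all_algebra.
From mathcomp Require Import boolp classical_sets cardinality.

Set Implicit Arguments.
Unset Strict Implicit.
Unset Printing Implicit Defensive.

Import GRing.Theory.
Local Open Scope classical_set_scope.
Local Open Scope ring_scope.

Section NumericalSemigroup.
Local Open Scope nat_scope.

Definition submonoid (A : set nat) : Prop :=
  A 0 /\ (forall x y, A x -> A y -> A (x + y)).

(* Finiteness of the complement is equivalent to the generators having gcd 1. *)
Record numerical_semigroup := NumericalSemigroup {
  ns_set :> set nat;
  ns_submonoid : submonoid ns_set;
  ns_cofinite : finite_set (~` ns_set) }.

Definition generated_by (G : set nat) : set nat := smallest submonoid G.

(* The minimal set of generators is listed in increasing order, so that
   head 0 g is g_1 and size g is the embedding dimension. *)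
Definition minimal_generators (S : numerical_semigroup) (g : seq nat) : Prop :=
  [/\ sorted ltn g, generated_by [set` g] = S &
      forall G : set nat, G `<` [set` g] -> generated_by G <> S].

Lemma generated_by_submonoid G : submonoid (generated_by G).
Proof.
split=> [A [[A0 _] _] //|x y Gx Gy A GA].
by have [[_ AD] _] := GA; apply: AD; [exact: Gx A GA|exact: Gy A GA].
Qed.

Lemma minimal_generators_sub S g i :
  minimal_generators S g -> i \in g -> ns_set S i.
Proof. by move=> [_ <- _] ig A [_]; apply. Qed.

Lemma minimal_generators_gt0 S g i :
  minimal_generators S g -> i \in g -> 0 < i.
Proof.
move=> [_ gS gmin] ig; rewrite lt0n; apply/eqP => i0; rewrite {i}i0 in ig.
have [g0 gD] := generated_by_submonoid ([set` g] `\ 0).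
apply: (gmin ([set` g] `\ 0)).
  by split=> [x []//|/(_ 0 ig) [_ /(_ erefl)]].
rewrite -gS; apply/seteqP; split; apply: smallest_sub.
- exact: generated_by_submonoid.
- by move=> x [xg _]; apply: sub_gen_smallest.
- exact: generated_by_submonoid.
- move=> x xg; have [->//|x0] := eqVneq x 0.
  by apply: sub_gen_smallest; split=> //; apply/eqP.
Qed.

Lemma minimal_generators_sub_gen S g s : minimal_generators S g ->
  ns_set S s -> 0 < s -> exists i, [/\ i \in g, i <= s & ns_set S (s - i)].
Proof.
move=> Sg; have [_ gS _] := Sg; have [S0 SD] := ns_submonoid S.
rewrite -{1}gS => /(_ [set s | ns_set S s /\ (0 < s ->
  exists i, [/\ i \in g, i <= s & ns_set S (s - i)])])[]//.
split=> [|i /= ig]; last first.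
  split; first exact: minimal_generators_sub ig.
  by move=> _; exists i; rewrite subnn.
split=> // x y [Sx gx] [Sy gy]; split; first exact: SD.
have [->|x0 _] := posnP x; first by rewrite add0n.
have [i [ig ix Sxi]] := gx x0; exists i.
by rewrite -addnBAC // (leq_trans ix) ?leq_addr //; split=> //; apply: SD.
Qed.

End NumericalSemigroup.

Record fps (k : Type) := Fps { fps_coef :> nat -> k }.

HB.instance Definition _ (k : Type) := gen_eqMixin (fps k).
HB.instance Definition _ (k : Type) := gen_choiceMixin (fps k).

Lemma fpsP (k : Type) (f g : fps k) : (forall n, f n = g n) -> f = g.
Proof. by case: f => f; case: g => g /= fg; congr Fps; apply/funext. Qed.

Section FpsRing.
Variable k : comNzRingType.
Implicit Types (f g h : fps k) (a b : k) (n : nat).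

Definition fps_zero : fps k := Fps (fun=> 0).
Definition fps_opp f : fps k := Fps (fun n => - f n).
Definition fps_add f g : fps k := Fps (fun n => f n + g n).
Definition fps_scale a f : fps k := Fps (fun n => a * f n).
Definition fps_monom i : fps k := Fps (fun n => (n == i)%:R).
Definition fps_mul f g : fps k :=
  Fps (fun n => \sum_(j < n.+1) f j * g (n - j)%N).

Fact fps_addA : associative fps_add.
Proof. by move=> f g h; apply: fpsP => n /=; rewrite addrA. Qed.
Fact fps_addC : commutative fps_add.
Proof. by move=> f g; apply: fpsP => n /=; rewrite addrC. Qed.
Fact fps_add0 : left_id fps_zero fps_add.
Proof. by move=> f; apply: fpsP => n /=; rewrite add0r. Qed.
Fact fps_addN : left_inverse fps_zero fps_opp fps_add.
Proof. by move=> f; apply: fpsP => n /=; rewrite addNr. Qed.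
HB.instance Definition _ := GRing.isZmodule.Build (fps k)
  fps_addA fps_addC fps_add0 fps_addN.

Let trunc N f : {poly k} := \poly_(i < N.+1) f i.

Let truncE N f n : (n <= N)%N -> (trunc N f)`_n = f n.
Proof. by move=> nN; rewrite coef_poly ltnS nN. Qed.

Let fps_mulE N f g n : (n <= N)%N -> fps_mul f g n = (trunc N f * trunc N g)`_n.
Proof.
move=> nN; rewrite coefM; apply: eq_bigr => j _; rewrite !truncE //.
  by apply: leq_trans nN; rewrite leq_subr.
by apply: leq_trans nN; rewrite -ltnS.
Qed.

Fact fps_mulA : associative fps_mul.
Proof.
move=> f g h; apply: fpsP => n.
transitivity ((trunc n f * (trunc n g * trunc n h))`_n).
  rewrite coefM; apply: eq_bigr => j _.
  by rewrite truncE -1?ltnS // -fps_mulE ?leq_subr.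
rewrite mulrA coefM; apply: eq_bigr => j _.
by rewrite truncE ?leq_subr // -fps_mulE // -ltnS.
Qed.
Fact fps_mulC : commutative fps_mul.
Proof. by move=> f g; apply: fpsP => n; rewrite !(fps_mulE _ _ (leqnn n)) mulrC. Qed.
Fact fps_mul1 : left_id (fps_monom 0) fps_mul.
Proof.
move=> f; apply: fpsP => n /=; rewrite big_ord_recl /= mul1r subn0.
by rewrite big1 ?addr0 // => i _; rewrite mul0r.
Qed.
Fact fps_mulDl : left_distributive fps_mul fps_add.
Proof.
move=> f g h; apply: fpsP => n /=; rewrite -big_split /=.
by apply: eq_bigr => i _; rewrite mulrDl.
Qed.
Fact fps_one_neq0 : fps_monom 0 != 0.
Proof.
by apply/eqP => /(congr1 (fun f : fps k => f 0%N)) /eqP /=; rewrite oner_eq0.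
Qed.
HB.instance Definition _ := GRing.Zmodule_isComNzRing.Build (fps k)
  fps_mulA fps_mulC fps_mul1 fps_mulDl fps_one_neq0.

Fact fps_scaleA a b f : fps_scale a (fps_scale b f) = fps_scale (a * b) f.
Proof. by apply: fpsP => n /=; rewrite mulrA. Qed.
Fact fps_scale1 : left_id 1 fps_scale.
Proof. by move=> f; apply: fpsP => n /=; rewrite mul1r. Qed.
Fact fps_scaleDr : right_distributive fps_scale +%R.
Proof. by move=> a f g; apply: fpsP => n /=; rewrite mulrDr. Qed.
Fact fps_scaleDl f : {morph fps_scale^~ f : a b / a + b}.
Proof. by move=> a b; apply: fpsP => n /=; rewrite mulrDl. Qed.
HB.instance Definition _ := GRing.Zmodule_isLmodule.Build k (fps k)
  fps_scaleA fps_scale1 fps_scaleDr fps_scaleDl.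

Fact fps_scaleAl a f g : a *: (f * g) = a *: f * g.
Proof.
apply: fpsP => n; rewrite [LHS]mulr_sumr.
by apply: eq_bigr => i _; rewrite mulrA.
Qed.
HB.instance Definition _ := GRing.Lmodule_isLalgebra.Build k (fps k) fps_scaleAl.
HB.instance Definition _ := GRing.Lalgebra_isComAlgebra.Build k (fps k).

Lemma fpsD f g n : (f + g) n = f n + g n. Proof. by []. Qed.
Lemma fpsN f n : (- f) n = - f n. Proof. by []. Qed.
Lemma fpsZ a f n : (a *: f) n = a * f n. Proof. by []. Qed.
Lemma fpsM f g n : (f * g) n = \sum_(j < n.+1) f j * g (n - j)%N.
Proof. by []. Qed.
Lemma fps0 n : (0 : fps k) n = 0. Proof. by []. Qed.
Lemma fps1 n : (1 : fps k) n = (n == 0%N)%:R. Proof. by []. Qed.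
Lemma fps_sum (I : Type) (r : seq I) (P : pred I) (F : I -> fps k) n :
  (\sum_(i <- r | P i) F i) n = \sum_(i <- r | P i) F i n.
Proof. exact: (big_morph (fun f : fps k => f n) (fun f g => fpsD f g n)). Qed.

Lemma fps_monomM i f n :
  (fps_monom i * f) n = if (i <= n)%N then f (n - i)%N else 0.
Proof.
rewrite fpsM; case: leqP => [i_n|n_i].
  have i_n1 : (i < n.+1)%N by rewrite ltnS.
  rewrite (bigD1 (Ordinal i_n1)) //= eqxx mul1r big1 ?addr0 // => j.
  by rewrite -val_eqE /= => /negPf ->; rewrite mul0r.
rewrite big1 // => j _ /=; rewrite [_ == i]ltn_eqF ?mul0r //.
by apply: leq_ltn_trans n_i; rewrite -ltnS.
Qed.

End FpsRing.

Section SemigroupRing.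
Variables (k : fieldType) (S : numerical_semigroup).

Definition fps_supported : {pred fps k} :=
  fun f => `[< forall n, f n != 0 -> ns_set S n >].

Fact fps_supported_subalg : subalg_closed fps_supported.
Proof.
case: (ns_submonoid S) => S0 SD; split.
- by apply/asboolP => -[|n] //; rewrite fps1 eqxx.
- move=> a f g /asboolP fS /asboolP gS; apply/asboolP => n.
  rewrite fpsD fpsZ; have [->|fn0 _] := eqVneq (f n) 0; last exact: fS.
  by rewrite mulr0 add0r => /gS.
move=> f g /asboolP fS /asboolP gS; apply/asboolP => n.
rewrite fpsM; apply: contra_neqP => Sn; rewrite big1 // => j _.
have [->|/fS Sj] := eqVneq (f j) 0; first by rewrite mul0r.
have [->|/gS Snj] := eqVneq (g (n - j)%N) 0; first by rewrite mulr0.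
by case: Sn; rewrite -(@subnKC j n) -1?ltnS //; exact: SD.
Qed.
HB.instance Definition _ :=
  GRing.isSubalgClosed.Build k (fps k) fps_supported fps_supported_subalg.

Record semigroup_ring :=
  SemigroupRing { sr_val :> fps k; _ : sr_val \in fps_supported }.

HB.instance Definition _ := [isSub for sr_val].
HB.instance Definition _ := [Choice of semigroup_ring by <:].
HB.instance Definition _ := [SubChoice_isSubComNzRing of semigroup_ring by <:].
HB.instance Definition _ := [SubZmodule_isSubLmodule of semigroup_ring by <:].
HB.instance Definition _ :=
  [SubNzRing_SubLmodule_isSubLalgebra of semigroup_ring by <:].
HB.instance Definition _ := [SubLalgebra_isSubAlgebra of semigroup_ring by <:].

Lemma sr_valD (x y : semigroup_ring) : sr_val (x + y) = sr_val x + sr_val y.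
Proof. exact: (raddfD val). Qed.
Lemma sr_valN (x : semigroup_ring) : sr_val (- x) = - sr_val x.
Proof. exact: (raddfN val). Qed.
Lemma sr_valM (x y : semigroup_ring) : sr_val (x * y) = sr_val x * sr_val y.
Proof. exact: (rmorphM val). Qed.
Lemma sr_val1 : sr_val (1 : semigroup_ring) = 1.
Proof. exact: (rmorph1 val). Qed.
Lemma sr_valZ a (x : semigroup_ring) : sr_val (a *: x) = a *: sr_val x.
Proof. by []. Qed.
Lemma sr_val_sum (I : Type) (r : seq I) (P : pred I) (F : I -> semigroup_ring) :
  sr_val (\sum_(i <- r | P i) F i) = \sum_(i <- r | P i) sr_val (F i).
Proof. exact: (raddf_sum val). Qed.

End SemigroupRing.

Section Ideals.
Variable A : comNzRingType.
Implicit Types (I J X : set A).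

Definition is_ideal I : Prop :=
  [/\ I 0, forall x y, I x -> I y -> I (x + y) & forall a x, I x -> I (a * x)].

Definition ideal_gen X : set A := smallest is_ideal X.

Definition ideal_mul I J : set A :=
  ideal_gen [set z | exists x y, [/\ I x, J y & z = x * y]].

Definition ideal_exp I n : set A := iter n (ideal_mul I) setT.

Lemma ideal_gen_is_ideal X : is_ideal (ideal_gen X).
Proof.
split.
- by move=> I [[I0 _ _] _].
- by move=> x y Ix Iy I IX; have [[_ ID _] _] := IX; apply: ID; [exact: Ix I IX|exact: Iy I IX].
- by move=> a x Ix I IX; have [[_ _ IM] _] := IX; apply: IM; exact: Ix I IX.
Qed.

Lemma ideal_exp_is_ideal I n : is_ideal (ideal_exp I n).
Proof. by case: n => [|n] //; apply: ideal_gen_is_ideal. Qed.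

Lemma ideal_expS_mul I n x y :
  I x -> ideal_exp I n y -> ideal_exp I n.+1 (x * y).
Proof. by move=> Ix Iy J [_ XJ]; apply: XJ; exists x, y. Qed.

Lemma ideal_sum I (T : Type) (r : seq T) (P : pred T) (F : T -> A) :
  is_ideal I -> (forall i, P i -> I (F i)) -> I (\sum_(i <- r | P i) F i).
Proof. by case=> I0 ID _ IF; elim/big_ind: _. Qed.

Lemma idealB I x y : is_ideal I -> I x -> I y -> I (x - y).
Proof. by case=> _ ID IM Ix Iy; apply: ID => //; rewrite -mulN1r; apply: IM. Qed.

End Ideals.

Lemma idealZ (k : fieldType) (A : comAlgType k) (I : set A) c x :
  is_ideal I -> I x -> I (c *: x).
Proof. by case=> _ _ IM Ix; rewrite -mulr_algl; apply: IM. Qed.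

Section QuotientDimension.
Variables (k : fieldType) (E : lmodType k).
Implicit Types (U V : set E).

(* For subspaces V of U: the classes of b 0, ..., b (d - 1) form a k-basis of
   U / V. *)
Definition quotient_basis U V d (b : 'I_d -> E) : Prop :=
  [/\ forall i, U (b i),
      forall u, U u -> exists c : 'I_d -> k, V (u - \sum_i c i *: b i) &
      forall c : 'I_d -> k, V (\sum_i c i *: b i) -> forall i, c i = 0].

Definition has_quotient_dim U V d : Prop :=
  exists b : 'I_d -> E, quotient_basis U V b.

(* The default value 0 is only used when U / V is infinite-dimensional; see
   has_quotient_dim_uniq and hilbert_functionP below. *)
Definition quotient_dim U V : nat := xget 0%N (has_quotient_dim U V).

End QuotientDimension.

Section QuotientDimensionTheory.
Variables (k : fieldType) (A : comAlgType k) (U V : set A).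
Hypotheses (Uid : is_ideal U) (Vid : is_ideal V).

Lemma has_quotient_dim_le d d' :
  has_quotient_dim U V d -> has_quotient_dim U V d' -> (d' <= d)%N.
Proof.
move=> [b [Ub bgen _]] [b' [Ub' _ b'free]].
have [M HM] := choice (fun j => bgen _ (Ub' j)).
pose N : 'M[k]_(d', d) := \matrix_(j, i) M j i.
suff : row_free N by rewrite /row_free => /eqP <-; apply: rank_leq_col.
rewrite -kermx_eq0; apply/rowV0P => v /sub_kermxP vN0.
apply/rowP => j; rewrite mxE; apply: (b'free (v 0)); move: j => _.
have -> : \sum_j v 0 j *: b' j =
    \sum_j v 0 j *: (b' j - \sum_i M j i *: b i).
  apply/eqP; rewrite -subr_eq0 -sumrB; apply/eqP.
  under eq_bigr => j _ do rewrite -scalerBr opprB addrC subrK scaler_sumr.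
  rewrite exchange_big /= big1 // => i _.
  under eq_bigr => j _ do rewrite scalerA.
  rewrite -scaler_suml; have /matrixP/(_ 0 i) := vN0; rewrite !mxE => vNi.
  under eq_bigr => j _ do rewrite -[M j i](mxE matrix_key (fun j i => M j i)).
  by rewrite vNi scale0r.
by apply: ideal_sum => // j _; apply: idealZ.
Qed.

Lemma has_quotient_dim_uniq d d' :
  has_quotient_dim U V d -> has_quotient_dim U V d' -> d = d'.
Proof. by move=> ? ?; apply/eqP; rewrite eqn_leq !has_quotient_dim_le. Qed.

Lemma has_quotient_dim_ex d (b : 'I_d -> A) :
    (forall i, U (b i)) ->
    (forall u, U u -> exists c : 'I_d -> k, V (u - \sum_i c i *: b i)) ->
  exists d', has_quotient_dim U V d'.
Proof.
elim: d b => [|d IHd] b Ub bgen.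
  by exists 0%N, b; split=> // c _ [].
have [bfree|] := pselect (forall c : 'I_d.+1 -> k,
    V (\sum_i c i *: b i) -> forall i, c i = 0); first by exists d.+1, b.
move=> /existsNP[c /not_implyP[Vc /existsNP[i0 /eqP ci0]]].
apply: (IHd (fun j => b (lift i0 j))) => // u /bgen[e Ve].
exists (fun j => e (lift i0 j) - e i0 / c i0 * c (lift i0 j)).
have -> : u - \sum_j (e (lift i0 j) - e i0 / c i0 * c (lift i0 j)) *:
      b (lift i0 j) =
    (u - \sum_i e i *: b i) + (e i0 / c i0) *: \sum_i c i *: b i.
  rewrite !(bigD1_ord i0) //= scalerDr scalerA divfK //.
  rewrite opprD -addrA; congr (_ + _); rewrite addrACA addNr add0r.
  rewrite scaler_sumr -!sumrN -big_split /=; apply: eq_bigr => j _.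
  by rewrite scalerA scalerBl opprB addrC.
by case: Vid => _ VD _; apply: VD => //; apply: idealZ.
Qed.

Lemma quotient_dimP :
  (exists d, has_quotient_dim U V d) -> has_quotient_dim U V (quotient_dim U V).
Proof. by move=> [d Hd]; apply: (xgetI 0%N Hd). Qed.

End QuotientDimensionTheory.

Section IdealPowersFinite.
Variables (k : fieldType) (A : comAlgType k) (T : seq A).
Let m := ideal_gen [set` T].
Hypothesis kDm : forall a : A, exists c : k, m (a - c%:A).

Lemma ideal_exp_quotient_fg n : exists s : seq A,
  (forall i : 'I_(size s), ideal_exp m n s`_i) /\
  (forall u, ideal_exp m n u -> exists c : 'I_(size s) -> k,
     ideal_exp m n.+1 (u - \sum_i c i *: s`_i)).
Proof.
elim: n => [|n [s [sm sgen]]].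
  exists [:: 1]; split=> // u _; have [c mc] := kDm u; exists (fun=> c).
  by rewrite big_ord1 -[_ - _]mulr1; apply: ideal_expS_mul.
have [e0 eD eM] := ideal_exp_is_ideal m n.+1.
have V_id := ideal_exp_is_ideal m n.+2; have [V0 VD VM] := V_id.
pose s' := [seq x * y | x <- T, y <- s].
pose Q : set A := [set u | ideal_exp m n.+1 u /\
   exists c : 'I_(size s') -> k, ideal_exp m n.+2 (u - \sum_i c i *: s'`_i)].
have mT x : x \in T -> m x by move=> xT I [_ TI]; apply: TI.
have s'm (i : 'I_(size s')) : ideal_exp m n.+1 s'`_i.
  have /allpairsP[[x y] /= [xT ys ->]] := mem_nth 0 (ltn_ord i).
  apply: ideal_expS_mul; first exact: mT.
  by move: ys => /(nthP 0)[j js <-]; exact: (sm (Ordinal js)).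
have QV u : ideal_exp m n.+1 u -> ideal_exp m n.+2 u -> Q u.
  move=> u1 u2; split=> //; exists (fun=> 0).
  by rewrite big1 ?subr0 // => i _; rewrite scale0r.
have QD x y : Q x -> Q y -> Q (x + y).
  move=> [x1 [c cx]] [y1 [d dy]]; split; first exact: eD.
  exists (fun i => c i + d i); rewrite (_ : _ - _ =
    (x - \sum_i c i *: s'`_i) + (y - \sum_i d i *: s'`_i)); first exact: VD.
  rewrite addrACA -opprD -big_split /=; congr (_ - _).
  by apply: eq_bigr => i _; rewrite scalerDl.
have QZ a x : Q x -> Q (a *: x).
  move=> [x1 [c cx]]; split; first exact: (idealZ a (ideal_exp_is_ideal m n.+1) x1).
  exists (fun i => a * c i); rewrite (_ : _ - _ =
    a *: (x - \sum_i c i *: s'`_i)); first exact: (idealZ a V_id cx).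
  rewrite scalerBr scaler_sumr; congr (_ - _).
  by apply: eq_bigr => i _; rewrite scalerA.
have Qs' x : x \in s' -> Q x.
  move=> /(nthP 0)[j js <-]; split; first exact: (s'm (Ordinal js)).
  exists (fun i => (i == Ordinal js)%:R).
  rewrite (bigD1 (Ordinal js)) //= eqxx scale1r big1 ?addr0 ?subrr //.
  by move=> i /negPf ->; rewrite scale0r.
have Qid : is_ideal Q.
  split=> // [|a x Qx]; first exact: QV.
  have [c mc] := kDm a; have [x1 _] := Qx.
  rewrite -[a](subrK c%:A) mulrDl; apply: (QD).
    by apply: QV; [exact: eM|exact: ideal_expS_mul].
  by rewrite mulr_algl; apply: QZ.
have Q0 : Q 0 by case: Qid.
exists s'; split=> // u mu; suff [] : Q u by [].
apply: (mu Q); split=> // _ [x [y [mx my ->]]].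
pose P : set A := [set x | m x /\ forall y, ideal_exp m n y -> Q (x * y)].
suff [_ Px] : P x by exact: Px.
apply: (mx P); split; last first.
  move=> t /= tT; split; first exact: mT.
  move=> z mz; have [c Vc] := sgen _ mz.
  rewrite -[z](subrK (\sum_i c i *: s`_i)) mulrDr; apply: QD.
    apply: QV; last by apply: ideal_expS_mul => //; exact: mT.
    apply: ideal_expS_mul; first exact: mT.
    apply: idealB => //; first exact: ideal_exp_is_ideal.
    apply: ideal_sum => [|i _]; first exact: ideal_exp_is_ideal.
    by apply: idealZ => //; exact: ideal_exp_is_ideal.
  rewrite mulr_sumr; apply: ideal_sum => // i _.
  rewrite -scalerAr; apply: QZ; apply: Qs'.
  by apply: allpairs_f => //; apply: mem_nth.
have [m0 mD mM] := ideal_gen_is_ideal [set` T].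
split.
- by split=> // z _; rewrite mul0r.
- move=> x1 x2 [mx1 Q1] [mx2 Q2]; split; first exact: mD.
  by move=> z mz; rewrite mulrDl; apply: QD; [apply: Q1|apply: Q2].
- move=> a x1 [mx1 Q1]; split; first exact: mM.
  by move=> z mz; rewrite -mulrA; case: Qid => _ _; apply; apply: Q1.
Qed.

Lemma ideal_exp_has_quotient_dim n :
  has_quotient_dim (ideal_exp m n) (ideal_exp m n.+1)
    (quotient_dim (ideal_exp m n) (ideal_exp m n.+1)).
Proof.
have [s [sm sgen]] := ideal_exp_quotient_fg n.
apply: quotient_dimP; apply: (has_quotient_dim_ex _ sm sgen).
exact: ideal_exp_is_ideal.
Qed.

End IdealPowersFinite.

Section HilbertFunction.
Variables (k : fieldType) (S : numerical_semigroup) (g : seq nat).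

(* The maximal ideal (t^g_1, ..., t^g_n) of k[[t^S]]. *)
Definition semigroup_max_ideal : set (semigroup_ring k S) :=
  ideal_gen [set x : semigroup_ring k S |
    exists2 i, i \in g & sr_val x = fps_monom k i].

Definition hilbert_function (h : nat) : nat :=
  quotient_dim (ideal_exp semigroup_max_ideal h)
               (ideal_exp semigroup_max_ideal h.+1).

Hypothesis Sg : minimal_generators S g.

Lemma sr_valP (x : semigroup_ring k S) n : x n != 0 -> ns_set S n.
Proof. by case: x => x /= /asboolP; apply. Qed.

Lemma semigroup_max_idealP (x : semigroup_ring k S) :
  semigroup_max_ideal x <-> x 0%N = 0.
Proof.
have [m0 mD mM] := ideal_gen_is_ideal [set x : semigroup_ring k S |
    exists2 i, i \in g & sr_val x = fps_monom k i].
split=> [/(_ [set x : semigroup_ring k S | x 0%N = 0])|x0].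
  apply; split; first split=> //.
  - by move=> y z y0 z0; rewrite /mkset sr_valD fpsD y0 z0 addr0.
  - by move=> a y y0; rewrite /mkset sr_valM fpsM big_ord1 y0 mulr0.
  move=> y [i ig] /= ->; case: i ig => // /(minimal_generators_gt0 Sg).
  by rewrite ltnn.
have /choice[p pP] (n : nat) : exists i, ns_set S n -> (0 < n)%N ->
    [/\ i \in g, (i <= n)%N & ns_set S (n - i)%N].
  have [[Sn n0]|nS] := pselect (ns_set S n /\ (0 < n)%N); last first.
    by exists 0%N => Sn n0; case: nS.
  by have [i ?] := minimal_generators_sub_gen Sg Sn n0; exists i.
have /choice[t tE] (i : nat) : exists t : semigroup_ring k S,
    i \in g -> sr_val t = fps_monom k i.
  have [ig|/negP ng] := boolP (i \in g); last by exists 0.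
  suff fS : fps_monom k i \in fps_supported S by exists (SemigroupRing fS).
  apply/asboolP => n /=; have [->|] := eqVneq n i; last by rewrite eqxx.
  by move=> _; exact: minimal_generators_sub ig.
have /choice[q qE] (i : nat) : exists q : semigroup_ring k S, forall n,
    q n = if ((n + i)%N != 0%N) && (p (n + i)%N == i) then x (n + i)%N else 0.
  pose f := Fps (fun n => if ((n + i)%N != 0%N) && (p (n + i)%N == i)
    then x (n + i)%N else 0).
  suff fS : f \in fps_supported S by exists (SemigroupRing fS).
  apply/asboolP => n /=; case: ifP => [/andP[ni0 /eqP pni]|]; last first.
    by rewrite eqxx.
  move=> /sr_valP Sni; have [|_ _] := pP _ Sni; first by rewrite lt0n.
  by rewrite pni addnK.
have -> : x = \sum_(i <- g) q i * t i.
  have g_uniq : uniq g.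
    by case: Sg => + _ _; apply: sorted_uniq; [exact: ltn_trans|exact: ltnn].
  apply: val_inj; rewrite [RHS]sr_val_sum; apply: fpsP => n.
  rewrite fps_sum big_seq.
  under eq_bigr => i ig do rewrite sr_valM (tE i ig) mulrC fps_monomM qE.
  have [xn0|xn0] := eqVneq (x n) 0.
    rewrite [LHS]xn0 big1 // => i _; case: ifP => // ilen.
    by rewrite subnK // xn0; case: ifP.
  have n0 : (0 < n)%N.
    by rewrite lt0n; apply: contra_neq xn0 => ->.
  have [pg pn _] := pP n (sr_valP xn0) n0.
  rewrite -big_seq (bigD1_seq (p n)) //= pn subnK // -lt0n n0 eqxx /=.
  rewrite big1 ?addr0 // => i /negPf pni; case: ifP => // ilen.
  by rewrite subnK // [p n == i]eq_sym pni andbF.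
rewrite big_seq; apply: ideal_sum => [|i ig]; first by split.
by apply: mM; apply: sub_gen_smallest; exists i => //; apply: tE.
Qed.

Lemma hilbert_functionP h :
  has_quotient_dim (ideal_exp semigroup_max_ideal h)
                   (ideal_exp semigroup_max_ideal h.+1) (hilbert_function h).
Proof.
have /choice[t tE] (i : nat) : exists t : semigroup_ring k S,
    i \in g -> sr_val t = fps_monom k i.
  have [ig|/negP ng] := boolP (i \in g); last by exists 0.
  suff fS : fps_monom k i \in fps_supported S by exists (SemigroupRing fS).
  apply/asboolP => n /=; have [->|] := eqVneq n i; last by rewrite eqxx.
  by move=> _; exact: minimal_generators_sub ig.
have tm : [set x : semigroup_ring k S |
    exists2 i, i \in g & sr_val x = fps_monom k i] = [set` map t g].
  apply/seteqP; split=> [x [i ig xi]|x /mapP[i ig ->]]; last first.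
    by exists i => //; apply: tE.
  by apply/mapP; exists i => //; apply: val_inj; rewrite [LHS]xi -tE.
rewrite /hilbert_function.
have := @ideal_exp_has_quotient_dim k (semigroup_ring k S) (map t g).
rewrite -tm; apply => a; exists (a 0%N); apply/semigroup_max_idealP.
by rewrite sr_valD sr_valN sr_valZ sr_val1 fpsD fpsN fpsZ fps1 mulr1 subrr.
Qed.

End HilbertFunction.

(* Main.v *)
Require Import Defs.
From mathcomp Require Import all_boot all_order all_algebra.
From mathcomp Require Import boolp classical_sets cardinality.
From mathcomp Require Import zify.
Set Implicit Arguments.
Unset Strict Implicit.
Unset Printing Implicit Defensive.

Import GRing.Theory.

(** The ideal m^h consists of the series supported in hM, so the monomials t^n
    with n in hM but not in (h+1)M give a basis of m^h / m^(h+1)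
    ([max_ideal_exp_supp], [supp_max_ideal_exp]).  Write e for g_1 and call such
    an n an element of order h.  Adding e raises the order, so a residue class
    modulo e contains at most one element of order h; hence H(h) is the number
    of classes that contain one ([hilbert_function_classes]), and the Hilbert
    function decreases from q to q + 1 exactly when more classes are lost
    (order q occurs, order q + 1 does not) than gained (the reverse).

    Both kinds of classes are controlled by tight factorizations: those of
    maximal length such that no factorization of the same element and length
    involves e.  They are the monomials that survive in gr(R) modulo the initial
    form of t^e, so their sub-multisets are tight again.  The gained classes are
    those of the sums of the tight lists of length q + 1 ([tight_gained]).  A
    lost class contains an s of order q such that s + e has order at least
    q + 2, and a longest factorization of s + e is tight ([lost_tight]).

    Suppose that more classes are lost than gained.  The class of 0 is neither
    lost nor gained, and neither is the class of the least sum of a tight list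
    of length q ([common_class]).  With e <= 8 this leaves at most six classes
    for the lost and gained ones, so at most two are gained.  Thus the tight
    lists of length h = q + 1 have at most two sums u <= v, whereas the lost
    classes provide tight lists of length greater than h which form an antichain
    for the divisibility order of S.

    The bound on the number of sums is very restrictive: exchanging two entries
    a < b of a long tight list changes the sum of a sublist of length h by b - a,
    so b - a = v - u.  A long tight list therefore is constant or has exactly two
    values at distance v - u ([tight_shape]).  In an antichain the pairs of
    values of two non-constant lists are disjoint ([mixed_apart]), and a constant
    list imposes one of the values of every non-constant one
    ([pure_low_mixed], [pure_high_mixed]).  An antichain with three members would
    hence involve six generators besides e ([antichain_le2]), one with two
    members is impossible when u = v ([antichain_le1]), and there is no long
    tight list at all when there is no tight list of length h. *)

(** * Orders and tight factorizations *)

Section Factorizations.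
Variable g : seq nat.
Implicit Types (L A B : seq nat) (h n : nat).

(** Membership in hM.  A lower bound on the length, instead of the length h
    itself, covers 0M = S by the same formula and makes hM decreasing in h. *)
Definition in_power h n :=
  exists L, [/\ all (mem g) L, h <= size L & sumn L = n].

Definition has_order h n := in_power h n /\ ~ in_power h.+1 n.

Lemma in_power_sumn L : all (mem g) L -> in_power (size L) (sumn L).
Proof. by exists L. Qed.

Lemma in_powerW h h' n : h' <= h -> in_power h n -> in_power h' n.
Proof. by move=> hh [L [gL sL <-]]; exists L; split=> //; apply: leq_trans sL. Qed.

Lemma in_powerD h h' n n' :
  in_power h n -> in_power h' n' -> in_power (h + h') (n + n').
Proof.
move=> [L [gL sL <-]] [L' [gL' sL' <-]]; exists (L ++ L').
by rewrite all_cat gL size_cat leq_add // sumn_cat.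
Qed.

Variable e : nat.
Hypotheses (e_gt0 : 0 < e) (eg : e \in g).
Hypothesis e_min : forall x, x \in g -> e <= x.

(** The sums of the tight lists of size h index a basis of the degree h part of
    the quotient of gr(R) by the initial form of t^e. *)
Definition tight L := all (mem g) L /\
  forall L', all (mem g) L' -> sumn L' = sumn L ->
    size L' <= size L /\ (size L' = size L -> e \notin L').

Lemma sumn_ge L : all (mem g) L -> size L * e <= sumn L.
Proof.
elim: L => //= x L IH /andP[/e_min ex /IH]; rewrite mulSn; exact: leq_add.
Qed.

Lemma in_power_mule j : in_power j (j * e).
Proof.
exists (nseq j e); rewrite size_nseq sumn_nseq mulnC; split=> //.
by apply/allP => x /nseqP[-> _].
Qed.

Lemma has_order_mule j : has_order j (j * e).
Proof.
split=> [|[L [gL sL sumL]]]; first exact: in_power_mule.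
have := sumn_ge gL; rewrite sumL leq_pmul2r //; lia.
Qed.

(** A better factorization of a part would give a better one of the whole. *)
Lemma tight_catl A B : tight (A ++ B) -> tight A.
Proof.
move=> [+ tL]; rewrite all_cat => /andP[gA gB]; split=> // L' gL' sumL'.
have [||le eq] := tL (L' ++ B); first by rewrite all_cat gL'.
  by rewrite !sumn_cat sumL'.
move: le eq; rewrite !size_cat leq_add2r => le eq; split=> // sL'.
by have := eq (congr1 (addn^~ _) sL'); rewrite mem_cat negb_or => /andP[].
Qed.

(** Tightness is a property of the sum and of the length only; this lets one
    trade a factorization for another one of the same length. *)
Lemma tight_eq A B : tight A -> all (mem g) B -> size B = size A ->
  sumn B = sumn A -> tight B.
Proof. by move=> [gA tA] gB sB sumB; split=> //; rewrite sB sumB. Qed.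

Lemma tight_perm A B : perm_eq A B -> tight A -> tight B.
Proof.
move=> AB tA; apply: (tight_eq tA); last exact/esym/perm_sumn.
  by rewrite -(perm_all _ AB); case: tA.
exact/esym/perm_size.
Qed.

Lemma tight_gt L x : tight L -> x \in L -> e < x.
Proof.
move=> [gL tL] xL; have [_ /(_ erefl) eL] := tL L gL erefl.
rewrite ltn_neqAle e_min ?andbT; last exact: (allP gL).
by apply: contraNneq eL => ->.
Qed.

Lemma tight_sumn_ge L : tight L -> size L * e.+1 <= sumn L.
Proof.
move=> tL; have : all (fun x => e < x) L by apply/allP => x; apply: tight_gt.
by elim: L {tL} => //= x L IH /andP[ex /IH]; rewrite mulSn; apply: leq_add.
Qed.

Lemma tight_has_order L : tight L -> has_order (size L) (sumn L).
Proof.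
move=> [gL tL]; split=> [|[L' [gL' sL' /(tL _ gL')[]]]].
  exact: in_power_sumn.
by rewrite leqNgt sL'.
Qed.

(** Appending j copies of e to a factorization of n competes with L, and a tight
    L beats strictly any factorization in which e occurs. *)
Lemma tight_addl L n j h : tight L -> in_power h n -> sumn L = n + j * e ->
  0 < j -> h + j < size L.
Proof.
move=> [gL tL] [A [gA sA <-]] sumL j0.
pose L' := A ++ nseq j e.
have [||le eq] := tL L'.
- rewrite all_cat gA; apply/allP => x /nseqP[-> _]; exact: eg.
- by rewrite sumn_cat sumn_nseq sumL mulnC.
have sL' : size L' = size A + j by rewrite size_cat size_nseq.
have : size L' != size L.
  apply/eqP => /eq; rewrite mem_cat mem_nseq eqxx j0; lia.
lia.
Qed.

(** A longest factorization of n + e is tight: if one of that length contained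
    e, removing it would show that n has order greater than h. *)
Lemma tight_exists n h : has_order h n -> in_power h.+2 (n + e) ->
  exists L, [/\ tight L, h.+2 <= size L & sumn L = n + e].
Proof.
move=> [_ nh] [L0 [gL0 sL0 sumL0]].
pose P m := `[< exists L, [/\ all (mem g) L, size L = m & sumn L = n + e] >].
have exP : exists m, P m by exists (size L0); apply/asboolP; exists L0.
have ubP m : P m -> m <= n + e.
  move=> /asboolP[L [gL <- <-]]; apply: leq_trans (sumn_ge gL).
  by rewrite leq_pmulr.
case: (ex_maxnP exP ubP) => m /asboolP[L [gL sL sumL]] mmax.
have Lm : size L0 <= m by apply: mmax; apply/asboolP; exists L0.
exists L; split=> //; last by rewrite sL; apply: leq_trans Lm.
split=> // L' gL'; rewrite sumL => sumL'; split.
  by rewrite sL; apply: mmax; apply/asboolP; exists L'.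
move=> sL'; apply/negP => eL'; apply: nh; exists (rem e L'); split.
- by apply/allP => x /mem_rem; apply: (allP gL').
- by rewrite size_rem // sL' sL; move: (leq_trans sL0 Lm); case: (m).

- by have := perm_sumn (perm_to_rem eL') => /= E; apply/eqP; rewrite -(eqn_add2l e) -E sumL' addnC.
Qed.

Lemma tight_take j L : tight L -> tight (take j L).
Proof. by move=> tL; apply: (@tight_catl _ (drop j L)); rewrite cat_take_drop. Qed.

(** Divisibility in S of the sums. *)
Definition below A B := exists2 X, all (mem g) X & sumn B = sumn A + sumn X.

(** * Long tight lists when the short ones have at most two sums *)

Section TwoSums.
Variables h u v : nat.
Hypotheses (h_gt1 : 1 < h) (uv : u <= v).
Hypothesis sum_uv : forall A, tight A -> size A = h -> sumn A = u \/ sumn A = v.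

(** Take x, y and h - 1 further entries: dropping x or y leaves two tight lists
    of size h whose sums differ by y - x, so these sums are u and v. *)
Lemma exchange_step L x y : tight L -> h < size L -> x \in L -> y \in L ->
  x < y -> y + u = x + v.
Proof.
move=> tL hL xL yL xy.
have xy0 : y \in rem x L.
  have := perm_mem (perm_to_rem xL) y.
  by rewrite yL inE (gtn_eqF xy) /= => <-.
pose W := rem y (rem x L).
have pL : perm_eq L (x :: y :: W).
  apply: perm_trans (perm_to_rem xL) _.
  by rewrite perm_cons perm_to_rem.
have sW : size L = (size W).+2 by rewrite (perm_size pL).
have sW' : size (take h.-1 W) = h.-1 by rewrite size_takel //; lia.
have tx : tight (x :: take h.-1 W).
  apply: (@tight_catl _ (y :: drop h.-1 W)).
  apply: tight_perm tL; apply: perm_trans pL _.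
  rewrite /= perm_cons -cat_rcons -cats1.
  by rewrite -{1}(cat_take_drop h.-1 W) perm_sym -catA perm_catCA.
have ty : tight (y :: take h.-1 W).
  apply: (@tight_catl _ (x :: drop h.-1 W)).
  apply: tight_perm tL; apply: perm_trans pL _.
  rewrite (perm_catCA [:: x] [:: y] W) /= perm_cons -cat_rcons -cats1.
  by rewrite -{1}(cat_take_drop h.-1 W) perm_sym -catA perm_catCA.
have := sum_uv tx; have := sum_uv ty; rewrite /= sW'.
move=> /(_ (ltn_predK h_gt1)) ? /(_ (ltn_predK h_gt1)) ?; lia.
Qed.

Definition pure w x L := L = nseq (size L) x /\ h * x = w.
Definition mixed a b L :=
  [/\ a < b, a \in L, b \in L & forall z, z \in L -> z = a \/ z = b].

(** All differences of distinct entries equal v - u, and three distinct numbers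
    cannot be pairwise at the same distance. *)
Lemma tight_shape L : tight L -> h < size L ->
  [\/ exists x, pure u x L, exists x, pure v x L | exists a b, mixed a b L].
Proof.
move=> tL hL; case: L tL hL => // x L tL hL.
have [/all_pred1P|] := boolP (all (pred1 x) (x :: L)).
  move=> Lx; have := sum_uv (tight_take h tL).
  rewrite size_takel 1?ltnW // => /(_ erefl).
  have -> : sumn (take h (x :: L)) = h * x.
    by rewrite Lx take_nseq 1?ltnW // sumn_nseq mulnC.
  by case=> hx; [constructor 1|constructor 2]; exists x.
move=> /allPn[y yL /= yx]; constructor 3.
have xL : x \in x :: L by rewrite mem_head.
have E a b (aL : a \in x :: L) (bL : b \in x :: L) := exchange_step tL hL aL bL.
have [xy|yx'|/eqP] := ltngtP x y; last by rewrite eq_sym (negPf yx).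
- exists x, y; split=> // z zL.
  have := E _ _ xL yL; have := E _ _ yL xL; have := E _ _ xL zL.
  by have := E _ _ zL xL; have := E _ _ zL yL; have := E _ _ yL zL; lia.
- exists y, x; split=> // z zL.
  have := E _ _ xL yL; have := E _ _ yL xL; have := E _ _ xL zL.
  by have := E _ _ zL xL; have := E _ _ zL yL; have := E _ _ yL zL; lia.
Qed.

Lemma mixed_perm a b L : mixed a b L -> exists q p,
  [/\ perm_eq L (nseq q a ++ nseq p b), 0 < q & 0 < p].
Proof.
move=> [ab aL bL Lab].
exists (size (filter (pred1 a) L)), (size (filter (predC (pred1 a)) L)).
rewrite !size_filter -!has_count; split.
- have Fa : filter (pred1 a) L = nseq (count (pred1 a) L) a.
    by have /all_pred1P := filter_all (pred1 a) L; rewrite size_filter.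
  have Fb : filter (predC (pred1 a)) L = nseq (count (predC (pred1 a)) L) b.
    rewrite -size_filter; apply/all_pred1P/allP => z.
    rewrite mem_filter => /andP[/= za /Lab[za'|->]] //.
    by rewrite za' eqxx in za.
  by rewrite perm_sym -Fa -Fb; apply/permPl; exact: perm_filterC.
- by apply/hasP; exists a => //=.
- by apply/hasP; exists b => //=; rewrite gtn_eqF.
Qed.

(** The sublists of size h of a list with q entries a and p entries b are
    determined by the number of b's in them, which ranges over an interval.
    Exactly two values i and i + 1 are possible, which forces the last two
    alternatives. *)
Lemma mixed_sums a b L : tight L -> h < size L -> mixed a b L ->
  exists i j q p, [/\ perm_eq L (nseq q a ++ nseq p b), h = i + j + 1,
    u = j.+1 * a + i * b /\ v = j * a + i.+1 * b,
    j < q /\ i < p & (p <= i.+1 \/ j = 0) /\ (q <= j.+1 \/ i = 0)].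
Proof.
move=> tL hL mL; have [q [p [pL q0 p0]]] := mixed_perm mL; have [ab _ _ _] := mL.
have sL : size L = q + p by rewrite (perm_size pL) size_cat !size_nseq.
have sums j i : j <= q -> i <= p -> i + j = h ->
    j * a + i * b = u \/ j * a + i * b = v.
  move=> jq ip ijh; have <- : sumn (nseq j a ++ nseq i b) = j * a + i * b.
    by rewrite sumn_cat !sumn_nseq mulnC (mulnC b).
  apply: sum_uv; last by rewrite size_cat !size_nseq addnC.
  apply: (@tight_catl _ (nseq (q - j) a ++ nseq (p - i) b)).
  apply: tight_perm tL; apply: perm_trans pL _.
  by rewrite -{1}(subnKC jq) -{1}(subnKC ip) !nseqD -!catA perm_cat2l perm_catCA.
have [i [j [hij jq ip qj]]] : exists i j,
    [/\ h = i + j + 1, j < q, i < p & q <= j.+1 \/ i = 0].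
  (* i is the least possible number of entries b *)
  have [hq|hq] := leqP h q; [exists 0, h.-1|exists (h - q), q.-1].
    by split; [lia|lia|lia|right].
  by split; [lia|lia|lia|left; lia].
have U := sums j.+1 i jq (ltnW ip) ltac:(lia).
have V := sums j i.+1 (ltnW jq) ip ltac:(lia).
have step m n : m * a + n.+1 * b + a = m.+1 * a + n * b + b.
  by rewrite !mulSn; lia.
have uvE : u = j.+1 * a + i * b /\ v = j * a + i.+1 * b.
  by move: (step j i) U V; lia.
exists i, j, q, p; split=> //; split=> //.
have [|ip2] := leqP p i.+1; [by left|right].
(* otherwise i + 2 entries b would give a third sum *)
case: j hij jq {qj} U V uvE => // j hij jq _ _ uvE.
have W := sums j i.+2 (ltnW (ltnW jq)) ip2 ltac:(lia).
by move: (step j i.+1) (step j.+1 i) W uvE; clear -ab; lia.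
Qed.

Lemma pure_below w x y L L' : pure w x L -> pure w y L' -> tight L -> tight L' ->
  size L <= size L' -> below L L'.
Proof.
move=> [Lx hx] [Ly hy] tL [gL' _] LL'.
have xy : x = y by apply/eqP; rewrite -(eqn_pmul2l (ltnW h_gt1)) hx hy.
exists (drop (size L) L'); first by apply/allP => z /mem_drop; apply: (allP gL').
by rewrite -{1}(cat_take_drop (size L) L') sumn_cat {1}Ly take_nseq // {3}Lx xy.
Qed.

(** The numbers i and j of [mixed_sums] are determined by u, a and b, and they
    determine p unless j = 0 and q unless i = 0.  As i + j = h - 1 > 0, the two
    lists share p or q. *)
Lemma mixed_below a b L L' : tight L -> tight L' -> h < size L -> h < size L' ->
  mixed a b L -> mixed a b L' -> below L L' \/ below L' L.
Proof.
move=> tL tL' hL hL' mL mL'; have [ab aL bL _] := mL.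
have ga : a \in g by case: tL => /allP/(_ a aL).
have gb : b \in g by case: tL => /allP/(_ b bL).
have [i [j [q [p [pL hij [ui vi] [jq ip] [pi qj]]]]]] := mixed_sums tL hL mL.
have [i' [j' [q' [p' [pL' hij' [ui' vi'] [jq' ip'] [pi' qj']]]]]] :=
  mixed_sums tL' hL' mL'.
have ii : i = i' by nia.
have jj : j = j' by lia.
have mk q1 p1 q2 p2 L1 L2 : perm_eq L1 (nseq q1 a ++ nseq p1 b) ->
    perm_eq L2 (nseq q2 a ++ nseq p2 b) -> q1 <= q2 -> p1 <= p2 -> below L1 L2.
  move=> P1 P2 Q P; exists (nseq (q2 - q1) a ++ nseq (p2 - p1) b).
    by rewrite all_cat !all_nseq /= ga gb !orbT.
  rewrite (perm_sumn P1) (perm_sumn P2) !sumn_cat !sumn_nseq.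
  by rewrite -{1}(subnKC Q) -{1}(subnKC P) !mulnDr; exact: addnACA.
have : (q <= q') && (p <= p') \/ (q' <= q) && (p' <= p).
  by clear -pi qj pi' qj' ip ip' jq jq' ii jj hij h_gt1; lia.
by case=> /andP[Q P]; [left; apply: mk pL pL' Q P|right; apply: mk pL' pL Q P].
Qed.

(** The sum u would be smaller than h b because of the first list and at least
    h b because of the second one. *)
Lemma mixed_chain a b c L L' : tight L -> tight L' -> h < size L -> h < size L' ->
  mixed a b L -> mixed b c L' -> False.
Proof.
move=> tL tL' hL hL' mL mL'; have [ab _ _ _] := mL; have [bc _ _ _] := mL'.
have [i [j [q [p [_ hij [ui _] _ _]]]]] := mixed_sums tL hL mL.
have [i' [j' [q' [p' [_ hij' [ui' _] _ _]]]]] := mixed_sums tL' hL' mL'.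
have : u < h * b by rewrite ui hij; nia.
have : h * b <= u by rewrite ui' hij'; nia.
lia.
Qed.

(** A tight list of size h + 1 containing both values links u and v: it is an
    extension of a list of sum u by b and of one of sum v by a. *)
Lemma mixed_core a b L : tight L -> h < size L -> mixed a b L -> exists W,
  [/\ tight W, size W = h.+1, sumn W = u + b & sumn W = v + a].
Proof.
move=> tL hL mL; have [ab aL bL _] := mL.
have [i [j [q [p [pL hij [ui vi] [jq ip] _]]]]] := mixed_sums tL hL mL.
exists (nseq j.+1 a ++ nseq i.+1 b).
rewrite sumn_cat size_cat !size_nseq !sumn_nseq; split; [|lia|lia|lia].
apply: (@tight_catl _ (nseq (q - j.+1) a ++ nseq (p - i.+1) b)).
apply: tight_perm tL; apply: perm_trans pL _.
by rewrite -{1}(subnKC jq) -{1}(subnKC ip) !nseqD -!catA perm_cat2l perm_catCA.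
Qed.

Lemma mixed_bounds a b L : tight L -> h < size L -> mixed a b L ->
  [/\ a < b, b + u = a + v, u < h * b & h * a < v].
Proof.
move=> tL hL mL; have [ab aL bL _] := mL.
have [i [j [q [p [pL hij [ui vi] [jq ip] _]]]]] := mixed_sums tL hL mL.
split=> //; first exact: (exchange_step tL hL aL bL ab).
- by rewrite ui hij; nia.
- by rewrite vi hij; nia.
Qed.

(** By [tight_eq], h copies of x and one y form another tight factorization of
    the sum of W. *)
Lemma replace_core x y W : tight W -> size W = h.+1 -> x \in g -> y \in g ->
  sumn W = h * x + y -> h.-1 * x + y = u \/ h.-1 * x + y = v.
Proof.
move=> tW sW gx gy sumW.
have sn k : sumn (y :: nseq k x) = k * x + y by rewrite /= sumn_nseq mulnC addnC.
have sh : h.-1.+1 = h by apply: ltn_predK h_gt1.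
rewrite -sn; apply: sum_uv; last by rewrite /= size_nseq.
apply: (@tight_catl _ [:: x]); apply: (tight_eq tW).
- by rewrite /= gy all_cat all_nseq /= gx orbT.
- by rewrite /= size_cat size_nseq sW addn1 sh.
- by rewrite sumn_cat sn sumW /= addn0 -{2}sh mulSn; lia.
Qed.

Lemma pure_mem w x L : tight L -> h < size L -> pure w x L -> x \in g.
Proof.
move=> [/allP gL _] hL [Lx _]; apply: gL; rewrite Lx mem_nseq eqxx andbT.
exact: leq_ltn_trans hL.
Qed.

(** Refactoring the core of L' as h copies of x and one b, the sum (h - 1) x + b
    must be u or v.  It is not u since x < b, and v leaves x = a only. *)
Lemma pure_low_mixed x a b L L' : tight L -> tight L' ->
  h < size L -> h < size L' -> pure u x L -> mixed a b L' -> x = a.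
Proof.
move=> tL tL' hL hL' pL mL; have [W [tW sW sumW _]] := mixed_core tL' hL' mL.
have gx := pure_mem tL hL pL; have [ab aL bL _] := mL; have [_ hx] := pL.
have gb : b \in g by case: tL' => /allP/(_ b bL).
have [_ E ub _] := mixed_bounds tL' hL' mL.
have xb : x < b by rewrite -(ltn_pmul2l (ltnW h_gt1)) hx.
have := replace_core tW sW gx gb; rewrite sumW hx => /(_ erefl).
have : h.-1 * x + x = u by rewrite -hx -{2}(ltn_predK h_gt1) mulSn addnC.
lia.
Qed.

Lemma pure_high_mixed y a b L L' : tight L -> tight L' ->
  h < size L -> h < size L' -> pure v y L -> mixed a b L' -> y = b.
Proof.
move=> tL tL' hL hL' pL mL; have [W [tW sW _ sumW]] := mixed_core tL' hL' mL.
have gy := pure_mem tL hL pL; have [ab aL bL _] := mL; have [_ hy] := pL.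
have ga : a \in g by case: tL' => /allP/(_ a aL).
have [_ E _ av] := mixed_bounds tL' hL' mL.
have ya : a < y by rewrite -(ltn_pmul2l (ltnW h_gt1)) hy.
have := replace_core tW sW gy ga; rewrite sumW hy => /(_ erefl).
have : h.-1 * y + y = v by rewrite -hy -{2}(ltn_predK h_gt1) mulSn addnC.
lia.
Qed.

(** Two pairs at the same distance v - u which meet are equal or consecutive. *)
Lemma mixed_apart a b a' b' L L' : tight L -> tight L' ->
  h < size L -> h < size L' -> ~ below L L' -> ~ below L' L ->
  mixed a b L -> mixed a' b' L' -> [/\ a != a', a != b', b != a' & b != b'].
Proof.
move=> tL tL' hL hL' i1 i2 mL mL'.
have [ab E _ _] := mixed_bounds tL hL mL.
have [ab' E' _ _] := mixed_bounds tL' hL' mL'.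
split; apply/eqP => ?; subst.
- have bb' : b = b' by lia.
  by subst; case: (mixed_below tL tL' hL hL' mL mL').
- exact: (mixed_chain tL' tL hL' hL mL' mL).
- exact: (mixed_chain tL tL' hL hL' mL mL').
- have aa' : a = a' by lia.
  by subst; case: (mixed_below tL tL' hL hL' mL mL').
Qed.

Lemma pure_pure_False w x y L L' : tight L -> tight L' ->
  ~ below L L' -> ~ below L' L -> pure w x L -> pure w y L' -> False.
Proof.
move=> tL tL' i1 i2 pL pL'; have [LL'|/ltnW LL'] := leqP (size L) (size L').
  by apply: i1; apply: pure_below pL pL' _ _ _.
by apply: i2; apply: pure_below pL' pL _ _ _.
Qed.

(** The mixed list would have the values x and y, so y - x = v - u = h (y - x),
    which contradicts h > 1. *)
Lemma pure_pure_mixed x y a b L L' L'' : tight L -> tight L' -> tight L'' ->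
  h < size L -> h < size L' -> h < size L'' ->
  pure u x L -> pure v y L' -> mixed a b L'' -> False.
Proof.
move=> tL tL' tL'' hL hL' hL'' pL pL' mL.
have [ab E _ _] := mixed_bounds tL'' hL'' mL.
have [[_ hx] [_ hy]] := (pL, pL').
have xa := pure_low_mixed tL tL'' hL hL'' pL mL.
have yb := pure_high_mixed tL' tL'' hL' hL'' pL' mL.
by nia.
Qed.

Lemma pure_mixed_mixed w x a b a' b' L L' L'' : w = u \/ w = v ->
  tight L -> tight L' -> tight L'' ->
  h < size L -> h < size L' -> h < size L'' ->
  ~ below L' L'' -> ~ below L'' L' ->
  pure w x L -> mixed a b L' -> mixed a' b' L'' -> False.
Proof.
move=> wuv tL tL' tL'' hL hL' hL'' i1 i2 pL mL mL'.
have [aa' _ _ bb'] := mixed_apart tL' tL'' hL' hL'' i1 i2 mL mL'.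
case: wuv => ?; subst w.
  move/eqP: aa'; apply.
  rewrite -(pure_low_mixed tL tL' hL hL' pL mL).
  exact: (pure_low_mixed tL tL'' hL hL'' pL mL').
move/eqP: bb'; apply.
rewrite -(pure_high_mixed tL tL' hL hL' pL mL).
exact: (pure_high_mixed tL tL'' hL hL'' pL mL').
Qed.

(** At most one member is pure of sum u on h entries, and at most one of sum v;
    the lemmas above exclude every other combination except three mixed lists,
    whose values together with e are seven generators. *)
Lemma antichain_le2 L1 L2 L3 : size g <= 6 ->
  tight L1 -> tight L2 -> tight L3 -> h < size L1 -> h < size L2 -> h < size L3 ->
  ~ below L1 L2 -> ~ below L2 L1 -> ~ below L1 L3 -> ~ below L3 L1 ->
  ~ below L2 L3 -> ~ below L3 L2 -> False.
Proof.
move=> g6 t1 t2 t3 h1 h2 h3 i12 i21 i13 i31 i23 i32.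
case: (tight_shape t1 h1) => [[x P]|[x P]|[a [b P]]];
case: (tight_shape t2 h2) => [[x' P']|[x' P']|[a' [b' P']]];
case: (tight_shape t3 h3) => [[x'' P'']|[x'' P'']|[a'' [b'' P'']]];
try solve
 [ exact: (pure_pure_False t1 t2 i12 i21 P P')
 | exact: (pure_pure_False t1 t3 i13 i31 P P'')
 | exact: (pure_pure_False t2 t3 i23 i32 P' P'')
 | exact: (pure_pure_mixed t1 t2 t3 h1 h2 h3 P P' P'')
 | exact: (pure_pure_mixed t2 t1 t3 h2 h1 h3 P' P P'')
 | exact: (pure_pure_mixed t1 t3 t2 h1 h3 h2 P P'' P')
 | exact: (pure_pure_mixed t3 t1 t2 h3 h1 h2 P'' P P')
 | exact: (pure_pure_mixed t2 t3 t1 h2 h3 h1 P' P'' P)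
 | exact: (pure_pure_mixed t3 t2 t1 h3 h2 h1 P'' P' P)
 | exact: (pure_mixed_mixed (or_introl erefl) t1 t2 t3 h1 h2 h3 i23 i32 P P' P'')
 | exact: (pure_mixed_mixed (or_intror erefl) t1 t2 t3 h1 h2 h3 i23 i32 P P' P'')
 | exact: (pure_mixed_mixed (or_introl erefl) t2 t1 t3 h2 h1 h3 i13 i31 P' P P'')
 | exact: (pure_mixed_mixed (or_intror erefl) t2 t1 t3 h2 h1 h3 i13 i31 P' P P'')
 | exact: (pure_mixed_mixed (or_introl erefl) t3 t1 t2 h3 h1 h2 i12 i21 P'' P P')
 | exact: (pure_mixed_mixed (or_intror erefl) t3 t1 t2 h3 h1 h2 i12 i21 P'' P P')
 ].
have [A1 A2 A3 A4] := mixed_apart t1 t2 h1 h2 i12 i21 P P'.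
have [B1 B2 B3 B4] := mixed_apart t1 t3 h1 h3 i13 i31 P P''.
have [C1 C2 C3 C4] := mixed_apart t2 t3 h2 h3 i23 i32 P' P''.
have [[ab aL1 bL1 _] [ab' aL2 bL2 _] [ab'' aL3 bL3 _]] := And3 P P' P''.
have G x L : tight L -> x \in L -> x \in g by move=> [/allP gL _]; apply: gL.
suff : size [:: e; a; b; a'; b'; a''; b''] <= size g by move/leq_trans/(_ g6).
apply: uniq_leq_size => [|x].
  have Ne x L : tight L -> x \in L -> e != x.
    by move=> tL xL; rewrite ltn_eqF ?(tight_gt tL).
  rewrite /= !inE !negb_or (Ne a L1) ?(Ne b L1) ?(Ne a' L2) ?(Ne b' L2) //.
  rewrite (Ne a'' L3) ?(Ne b'' L3) // A1 A2 A3 A4 B1 B2 B3 B4 C1 C2 C3 C4.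
  by rewrite !ltn_eqF.
rewrite !inE => /or4P[/eqP->|/eqP->|/eqP->|/or4P[]/eqP->] //;
  by [apply: G t1 _|apply: G t2 _|apply: G t3 _].
Qed.

Lemma antichain_le1 L1 L2 : u = v -> tight L1 -> tight L2 ->
  h < size L1 -> h < size L2 -> ~ below L1 L2 -> ~ below L2 L1 -> False.
Proof.
move=> uv' t1 t2 h1 h2 i12 i21.
have P L : tight L -> h < size L -> exists x, pure u x L.
  move=> tL hL; case: (tight_shape tL hL) => [//|[x]|[a [b mL]]].
    by rewrite -uv'; exists x.
  have [ab E _ _] := mixed_bounds tL hL mL; lia.
have [[x P1] [y P2]] := (P _ t1 h1, P _ t2 h2).
exact: (pure_pure_False t1 t2 i12 i21 P1 P2).
Qed.

End TwoSums.

(** * Residue classes lost and gained from one order to the next *)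


Lemma modn_eq_add n n' : n %% e = n' %% e -> n <= n' ->
  exists j, n' = n + j * e.
Proof.
move=> nn' le; have : e %| n' - n by rewrite -eqn_mod_dvd //; apply/eqP.
by case/dvdnP => j E; exists j; rewrite -E subnKC.
Qed.

Lemma has_order_inj h n n' :
  has_order h n -> has_order h n' -> n %% e = n' %% e -> n = n'.
Proof.
wlog le : n n' / n <= n' => [W on on' E|[hn _] [_ hn'] /modn_eq_add/(_ le)[j E]].
  by have [/W|/ltnW/W] := leqP n n'; [apply|move=> W'; apply/esym/W'].
case: j E => [|j] E; first by rewrite E addn0.
case: hn'; rewrite E -addn1; apply: in_powerD => //.
by apply: in_powerW (in_power_mule j.+1).
Qed.

Definition residue n : 'I_e := Ordinal (ltn_pmod n e_gt0).

Definition order_classes h : {set 'I_e} :=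
  [set r | `[< exists2 n, has_order h n & residue n = r >]].

Lemma residue_eq n n' : residue n = residue n' -> n %% e = n' %% e.
Proof. by move/(congr1 val). Qed.

Lemma mem_order_classes h n : has_order h n -> residue n \in order_classes h.
Proof. by move=> on; rewrite inE; apply/asboolP; exists n. Qed.

Lemma residue0_classes h : residue 0 \in order_classes h.
Proof.
have -> : residue 0 = residue (h * e) by apply: val_inj; rewrite /= modnMl mod0n.
exact/mem_order_classes/has_order_mule.
Qed.

Section Step.
Variable q : nat.
Let lost := order_classes q :\: order_classes q.+1.
Let gained := order_classes q.+1 :\: order_classes q.

(** The element s + e has order at least q + 1, and not q + 1 as the class is
    lost. *)
Lemma lost_tight r : r \in lost -> exists s L,
  [/\ has_order q s, residue s = r, tight L, q.+1 < size L & sumn L = s + e].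
Proof.
rewrite !inE => /andP[rN /asboolP[s os rs]].
have [L [tL qL sumL]] : exists L, [/\ tight L, q.+2 <= size L & sumn L = s + e].
  apply: tight_exists => //; apply: contrapT => nse.
  move/negP: rN; apply; apply/asboolP; exists (s + e); last first.
    by rewrite -rs; apply: val_inj; rewrite /= modnDr.
  split=> //; rewrite -addn1; apply: in_powerD; first by case: os.
  by have := in_power_mule 1; rewrite mul1n.
by exists s, L.
Qed.

Lemma tight_gained L : tight L -> size L = q.+1 -> residue (sumn L) \in gained.
Proof.
move=> tL sL; have oL := tight_has_order tL; rewrite sL in oL.
rewrite finset.in_setD (mem_order_classes oL) andbT inE; apply/asboolP => -[n on rn].
have nN : ~ in_power q.+1 n by case: on.
case: (leqP n (sumn L)) => [|/ltnW] le.
  have [[|j] E] := modn_eq_add (residue_eq rn) le.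
    by apply: nN; move: E; rewrite addn0 => <-; case: oL.
  by have := tight_addl tL (proj1 on) E isT; lia.
have [j E] := modn_eq_add (esym (residue_eq rn)) le.
apply: nN; rewrite E; apply: (@in_powerW (q.+1 + j)); first exact: leq_addr.
by apply: in_powerD; [case: oL|apply: in_power_mule].
Qed.

Lemma gained_uniq A B : tight A -> tight B -> size A = size B ->
  residue (sumn A) = residue (sumn B) -> sumn A = sumn B.
Proof.
move=> tA tB sAB /residue_eq; apply: (@has_order_inj (size A)).
  exact: tight_has_order.
by rewrite sAB; apply: tight_has_order.
Qed.

(** Otherwise s' would exceed s by a nonzero element of S, and have order greater
    than q. *)
Lemma lost_antichain s s' L L' : has_order q s -> has_order q s' ->
  sumn L = s + e -> sumn L' = s' + e -> below L L' -> s = s'.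
Proof.
move=> os os' sL sL' [X gX E]; have {E} E : s' = s + sumn X by lia.
case: X E gX => [|x X] E gX; first by rewrite E /= addn0.
case: os' => _ []; rewrite E -addn1; apply: in_powerD; first by case: os.
by exists (x :: X).
Qed.

(** If the least sum M of a tight list of size q were in a lost class, then
    sumn M + e would have a tight factorization of length at least q + 2; its
    first q entries sum to at least sumn M, and the others to at least 2 e. *)
Lemma common_class : 0 < q -> lost != finset.set0 ->
  exists2 r, r != residue 0 & r \in order_classes q :&: order_classes q.+1.
Proof.
move=> q0 /set0Pn[d /lost_tight[s [L [_ _ tL qL _]]]].
pose P m := `[< exists A, [/\ tight A, size A = q & sumn A = m] >].
have tqL A : tight A -> q.+1 < size A -> P (sumn (take q A)).
  move=> tA qA; apply/asboolP; exists (take q A).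
  by split=> //; [exact: tight_take|rewrite size_takel //; lia].
have exP : exists m, P m by exists (sumn (take q L)); apply: tqL.
case: (ex_minnP exP) => _ /asboolP[M [tM sM <-]] Mmin.
exists (residue (sumn M)).
  apply/eqP => /residue_eq E.
  have [j E'] := modn_eq_add (esym E) (leq0n _); rewrite add0n in E'.
  have := tight_sumn_ge tM; rewrite sM E' => le.
  have qj : q < j by rewrite -(ltn_pmul2r e_gt0); apply: leq_trans le; nia.
  have := @tight_addl _ 0 j 0 tM (in_power_sumn (L := [::]) isT) E'.
  by rewrite sM; lia.
have oM := tight_has_order tM; rewrite sM in oM.
have MK : residue (sumn M) \in order_classes q by apply: mem_order_classes.
rewrite inE MK /=; apply: contraT => MN.
have /lost_tight[s' [L' [os' rs' tL' qL' sumL']]] :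
  residue (sumn M) \in lost by rewrite inE MN MK.
have E := has_order_inj os' oM (residue_eq rs').
have := Mmin _ (tqL _ tL' qL').
have gL' : all (mem g) (drop q L').
  by apply/allP => x /mem_drop; case: tL' => /allP gL' _; apply: gL'.
have := sumn_ge gL'; rewrite size_drop.
have : sumn L' = sumn (take q L') + sumn (drop q L').
  by rewrite -sumn_cat cat_take_drop.
have : 2 * e <= (size L' - q) * e by rewrite leq_mul2r; lia.
lia.
Qed.

(** The bound 6 on the number of generators and the bound 8 on e come from
    [antichain_le2] and from the count c + (c + 1) > 6 for c > 2 gained
    classes. *)
Theorem card_order_classes_le : size g <= 6 -> e <= 8 ->
  #|order_classes q| <= #|order_classes q.+1|.
Proof.
move=> g6 e8; rewrite leqNgt; apply/negP => lt.
have Eq := cardsID (order_classes q.+1) (order_classes q).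
have Eq1 := cardsID (order_classes q) (order_classes q.+1).
rewrite finset.setIC in Eq1; rewrite -/lost in Eq; rewrite -/gained in Eq1.
have gl : #|gained| < #|lost| by lia.
have lost0 : lost != finset.set0 by rewrite -card_gt0; lia.
have q0 : 0 < q.
  case: (posnP q) => // q0; case/set0Pn: lost0 => d.
  rewrite !inE => /andP[/negP dN /asboolP[n [[L [gL _ <-]] nN] rn]]; case: dN.
  case: L gL nN rn => [|x L] gL nN rn; last by case: nN; rewrite q0; exists (x :: L).
  by apply/asboolP; have := residue0_classes q.+1; rewrite -rn inE => /asboolP.
have [m m0 mI] := common_class q0 lost0.
have I2 : 2 <= #|order_classes q :&: order_classes q.+1|.
  apply/card_gt1P; exists m, (residue 0); split=> //.
  by rewrite inE !residue0_classes.
have total : #|gained| + #|order_classes q| <= e.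
  rewrite -[X in _ <= X]card_ord -[X in _ <= X](cardsC (order_classes q)).
  rewrite addnC leq_add2l; apply: subset_leq_card; apply/fintype.subsetP => x.
  by rewrite !inE => /andP[].
have tgain A : tight A -> q.+1 < size A -> residue (sumn (take q.+1 A)) \in gained.
  move=> tA qA; apply: tight_gained; first exact: tight_take.
  by rewrite size_takel // ltnW.
have sum_gained r : r \in gained -> exists w, forall A, tight A ->
    size A = q.+1 -> residue (sumn A) = r -> sumn A = w.
  rewrite finset.in_setD => /andP[_]; rewrite inE => /asboolP[w ow rw]; exists w.
  move=> A tA sA rA; have := tight_has_order tA; rewrite sA => oA.
  by apply: (has_order_inj oA ow); apply: residue_eq; rewrite rA rw.
have q1 : 1 < q.+1 by [].
have : #|gained| = 0 \/ #|gained| = 1 \/ #|gained| = 2.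
  clear -Eq total gl I2 e8; lia.
case=> [/eqP|[/eqP|/eqP]].
- rewrite finset.cards_eq0 => /eqP g0; case/set0Pn: lost0 => d.
  case/lost_tight => s [L [_ _ tL qL _]]; have := tgain _ tL qL.
  by rewrite g0 inE.
- move=> /[dup] /eqP g1 /cards1P[r gr]; rewrite g1 in gl.
  have [u uP] := sum_gained r ltac:(by rewrite gr inE).
  have sums A : tight A -> size A = q.+1 -> sumn A = u \/ sumn A = u.
    move=> tA sA; left; apply: uP => //.
    by have := tight_gained tA sA; rewrite gr inE => /eqP.
  case/card_gt1P: gl => d1 [d2 [/lost_tight[s1 [L1 [o1 r1 t1 h1 S1]]]]].
  case/lost_tight => s2 [L2 [o2 r2 t2 h2 S2]] d12.
  apply: (antichain_le1 q1 (leqnn u) sums erefl t1 t2 h1 h2).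
    move=> /(lost_antichain o1 o2 S1 S2) E.
    by rewrite -r1 -r2 E eqxx in d12.
  move=> /(lost_antichain o2 o1 S2 S1) E.
  by rewrite -r1 -r2 E eqxx in d12.
move=> /[dup] /eqP g2 /cards2P[r [r' [rr' gr]]]; rewrite g2 in gl.
have [u uP] := sum_gained r ltac:(by rewrite gr !inE eqxx).
have [v vP] := sum_gained r' ltac:(by rewrite gr !inE eqxx orbT).
have sums A : tight A -> size A = q.+1 ->
    sumn A = minn u v \/ sumn A = maxn u v.
  move=> tA sA; have : sumn A = u \/ sumn A = v; last lia.
  have := tight_gained tA sA; rewrite gr !inE => /orP[]/eqP E.
    by left; apply: uP.
  by right; apply: vP.
case/card_gt2P: gl => d1 [d2 [d3 [[]]]].
move=> /lost_tight[s1 [L1 [o1 R1 t1 h1 S1]]].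
move=> /lost_tight[s2 [L2 [o2 R2 t2 h2 S2]]].
move=> /lost_tight[s3 [L3 [o3 R3 t3 h3 S3]]] [d12 d23 d31].
have N i j (si sj : nat) Li Lj : has_order q si -> has_order q sj ->
    sumn Li = si + e -> sumn Lj = sj + e -> residue si = i -> residue sj = j ->
    i != j -> ~ below Li Lj.
  move=> oi oj Si Sj <- <- ij /(lost_antichain oi oj Si Sj) E.
  by rewrite E eqxx in ij.
have uv : minn u v <= maxn u v by rewrite geq_min leq_max leqnn.
apply: (antichain_le2 q1 uv sums g6 t1 t2 t3 h1 h2 h3).
- exact: N o1 o2 S1 S2 R1 R2 d12.
- by apply: N o2 o1 S2 S1 R2 R1 _; rewrite eq_sym.
- by apply: N o1 o3 S1 S3 R1 R3 _; rewrite eq_sym.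
- exact: N o3 o1 S3 S1 R3 R1 d31.
- exact: N o2 o3 S2 S3 R2 R3 d23.
- by apply: N o3 o2 S3 S2 R3 R2 _; rewrite eq_sym.
Qed.

End Step.
End Factorizations.

(** * The Hilbert function counts residue classes *)

Section SemigroupRingPowers.
Variables (k : fieldType) (S : numerical_semigroup) (g : seq nat).
Hypothesis Sg : minimal_generators S g.
Local Notation m := (@semigroup_max_ideal k S g).

Lemma semigroup_in_power n : ns_set S n -> in_power g 0 n.
Proof.
have [_ gS _] := Sg; rewrite -{1}gS => /(_ (in_power g 0)); apply; split.
  split=> [|x y]; first by exists [::].
  exact: (@in_powerD g 0 0).
by move=> x xg; exists [:: x]; rewrite /= addn0 xg; split.
Qed.

Lemma in_power_semigroup h n : in_power g h n -> ns_set S n.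
Proof.
have [S0 SD] := ns_submonoid S; move=> [L [gL _ <-]].
elim: L gL => //= x L IH /andP[xg /IH]; apply: SD.
exact: minimal_generators_sub xg.
Qed.

Lemma semigroup_in_power1 n : ns_set S n -> 0 < n -> in_power g 1 n.
Proof.
by move=> /semigroup_in_power[[|x L] [gL _ <-]] //; exists (x :: L).
Qed.

Lemma sr_supported (c : nat -> k) :
  (forall n, c n != 0%R -> ns_set S n) ->
  exists x : semigroup_ring k S, forall n, x n = c n.
Proof.
move=> cS; have fS : Fps c \in fps_supported S by apply/asboolP.
by exists (SemigroupRing fS).
Qed.

Lemma sr_monom i : ns_set S i ->
  exists t : semigroup_ring k S, sr_val t = fps_monom k i.
Proof.
move=> Si; have [n|t tE] := @sr_supported (fun n => (n == i)%:R%R).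
  by have [->|] := eqVneq n i; last by rewrite eqxx.
by exists t; apply: fpsP.
Qed.

Lemma max_ideal_exp_supp h (x : semigroup_ring k S) n :
  ideal_exp m h x -> x n != 0%R -> in_power g h n.
Proof.
elim: h x n => [|h IH] x n xm; first by move=> /sr_valP/semigroup_in_power.
pose I : set (semigroup_ring k S) :=
  fun x => forall n, x n != 0%R -> in_power g h.+1 n.
suff Ix : I x by exact: Ix.
clear n.
apply: xm; split; first split.
- by move=> n; rewrite eqxx.
- move=> y z yP zP n; rewrite sr_valD fpsD.
  by have [->|/yP//] := eqVneq (y n) 0%R; rewrite add0r => /zP.
- move=> a y yP n; rewrite sr_valM fpsM; apply: contraNP => nP.
  apply/eqP; rewrite big1 // => j _.
  have [->|/sr_valP/semigroup_in_power aj] := eqVneq (a j) 0%R.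
    by rewrite mul0r.
  have [->|/yP yj] := eqVneq (y (n - j)) 0%R; first by rewrite mulr0.
  case: nP; rewrite -(@subnKC j n) -1?ltnS //.
  by rewrite -[h.+1]add0n; apply: in_powerD.
move=> _ [y [z [/(semigroup_max_idealP Sg) y0 zm ->]]] n.
rewrite sr_valM fpsM; apply: contraNP => nP.
apply/eqP; rewrite big1 // => j _.
have [->|yj] := eqVneq (y j) 0%R; first by rewrite mul0r.
have [->|/(IH _ _ zm) zj] := eqVneq (z (n - j)) 0%R; first by rewrite mulr0.
case: nP; rewrite -(@subnKC j n) -1?ltnS // -add1n; apply: in_powerD => //.
apply: semigroup_in_power1; first exact: sr_valP yj.
by rewrite lt0n; apply: contraNneq yj => ->; rewrite y0.
Qed.

Lemma in_power_split h n : exists i, in_power g h.+1 n ->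
  [/\ i \in g, i <= n & in_power g h (n - i)].
Proof.
have [[[|x L] [//= /andP[xg gL] hL <-]]|] := pselect (in_power g h.+1 n).
  by exists x => _; rewrite leq_addr addKn; split=> //; exists L.
by move=> nP; exists 0.
Qed.

(** Choose for every n in (h+1)M a generator p n with n - p n in hM, and collect
    the terms of x with the same p n: this writes x as a sum of t^i q_i over the
    generators i, where q_i is supported in hM. *)
Lemma supp_max_ideal_exp h (x : semigroup_ring k S) :
  (forall n, x n != 0%R -> in_power g h n) -> ideal_exp m h x.
Proof.
elim: h x => [//|h IH] x xP.
have /choice[p pP] := in_power_split h.
have /choice[t tE] (i : nat) : exists t : semigroup_ring k S,
    i \in g -> sr_val t = fps_monom k i.
  have [ig|/negP ng] := boolP (i \in g); last by exists 0%R.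
  by have [t tE] := sr_monom (minimal_generators_sub Sg ig); exists t.
pose c i n := if p (n + i) == i then x (n + i) else 0%R.
have cP i n : c i n != 0%R -> in_power g h n.
  rewrite /c; have [pni|_] := eqVneq (p (n + i)) i; last by rewrite eqxx.
  by move=> /xP/pP[_ _]; rewrite pni addnK.
have /choice[q qE] (i : nat) : exists q : semigroup_ring k S,
    forall n, q n = c i n.
  by apply: sr_supported => n /cP/in_power_semigroup.
have -> : x = (\sum_(i <- g) t i * q i)%R.
  have g_uniq : uniq g.
    by case: Sg => + _ _; apply: sorted_uniq; [exact: ltn_trans|exact: ltnn].
  apply: val_inj; rewrite [RHS]sr_val_sum; apply: fpsP => n.
  rewrite fps_sum big_seq.
  under eq_bigr => i ig do rewrite sr_valM (tE i ig) fps_monomM qE /c.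
  have [xn0|xn0] := eqVneq (x n) 0%R.
    rewrite [LHS]xn0 big1 // => i _; case: ifP => // ilen.
    by rewrite subnK // xn0; case: ifP.
  have [pg pn _] := pP n (xP _ xn0).
  rewrite -big_seq (bigD1_seq (p n)) //= pn subnK // eqxx.
  rewrite big1 ?addr0 // => i /negPf pni; case: ifP => // ilen.
  by rewrite subnK // [p n == i]eq_sym pni.
rewrite big_seq; apply: ideal_sum => [|i ig]; first exact: ideal_exp_is_ideal.
apply: ideal_expS_mul.
  by apply: sub_gen_smallest; exists i => //; apply: tE.
by apply: IH => n; rewrite qE => /cP.
Qed.

Variable e : nat.
Hypotheses (e_gt0 : 0 < e) (eg : e \in g).

(** Each class in [order_classes h] contains a single element of order h, and the
    monomials with these exponents form a basis of m^h / m^(h+1). *)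
Lemma hilbert_function_classes h :
  hilbert_function k S g h = #|order_classes g e_gt0 h|.
Proof.
apply: (has_quotient_dim_uniq (ideal_exp_is_ideal m h.+1)
  (hilbert_functionP k Sg h)).
set K := order_classes g e_gt0 h.
have /choice[r rP] (i : 'I_#|K|) : exists n,
    has_order g h n /\ residue e_gt0 n = enum_val i.
  have := enum_valP i; rewrite inE => /asboolP[n on rn]; by exists n.
have r_inj i j : r i = r j -> i = j.
  move=> E; apply: enum_val_inj; have [[_ <-] [_ <-]] := (rP i, rP j).
  by rewrite E.
have /choice[b bE] (i : 'I_#|K|) : exists b : semigroup_ring k S,
    sr_val b = fps_monom k (r i).
  by apply/sr_monom/(@in_power_semigroup h); have [[]] := rP i.
have coefE (c : 'I_#|K| -> k) n :
    sr_val (\sum_i c i *: b i)%R n = (\sum_i c i * (n == r i)%:R)%R.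
  rewrite sr_val_sum fps_sum; apply: eq_bigr => i _.
  by rewrite sr_valZ fpsZ bE.
have coef_r (c : 'I_#|K| -> k) i : sr_val (\sum_i c i *: b i)%R (r i) = c i.
  rewrite coefE (bigD1 i) //= eqxx mulr1 big1 ?addr0 // => j ji.
  have [/r_inj E|] := eqVneq (r i) (r j); last by rewrite mulr0.
  by rewrite E eqxx in ji.
exists b; split.
- move=> i; apply: supp_max_ideal_exp => n; rewrite bE /=.
  by have [->|] := eqVneq n (r i); [have [[]] := rP i|rewrite eqxx].
- move=> u um; exists (fun i => u (r i)); apply: supp_max_ideal_exp => n.
  rewrite sr_valD sr_valN fpsD fpsN.
  have [[i ->]|nr] := pselect (exists i, n = r i).
    by rewrite coef_r subrr eqxx.
  rewrite coefE big1 ?subr0 => [|i _]; last first.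
    have [E|] := eqVneq n (r i); last by rewrite mulr0.
    by case: nr; exists i.
  move=> un0; have nh := max_ideal_exp_supp um un0; apply: contrapT => nh1.
  have on : has_order g h n by [].
  have nK : residue e_gt0 n \in K by apply: mem_order_classes.
  case: nr; exists (enum_rank_in nK (residue e_gt0 n)).
  have [or rr] := rP (enum_rank_in nK (residue e_gt0 n)).
  apply: (has_order_inj eg on or).
  by rewrite enum_rankK_in // in rr; exact: esym (residue_eq rr).
move=> c cm i; apply/eqP; apply: contraT; rewrite -(coef_r c i).
move=> /(max_ideal_exp_supp cm) rh; have [[_ /(_ rh)]] := rP i; by [].
Qed.

End SemigroupRingPowers.

Theorem corollary2p13 (k : fieldType) (S : numerical_semigroup) (g : seq nat)
    (k_infinite : infinite_set (@setT k)) (gS : minimal_generators S g)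
    (ed_S : size g = 4%N \/ size g = 5%N) (g1_le8 : (head 0%N g <= 8)%N) :
  forall h : nat, (1 <= h)%N ->
    (hilbert_function k S g (h - 1) <= hilbert_function k S g h)%N.
Proof.
case=> // q _; rewrite subn1 /=.
case: g ed_S g1_le8 gS => [[]//|e G] ed_S /= e8 gS.
have eg : e \in e :: G by rewrite mem_head.
have e0 : 0 < e := minimal_generators_gt0 gS eg.
have e_min x : x \in e :: G -> e <= x.
  rewrite inE => /orP[/eqP->//|xG]; have [gs _ _] := gS.
  by have := order_path_min ltn_trans gs => /allP/(_ x xG)/ltnW.
rewrite !(hilbert_function_classes k gS e0 eg).
apply: card_order_classes_le => //; by case: ed_S => ->.
Qed.
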